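(* Let $f:\mathbb{R}^2\to\mathbb{R}$ be a coercive $C^{1,1}$ quasiconvex function. Then, for every $x_0\in\mathbb{R}^2$, the orbit $\gamma$ of the gradient flow $$\dot\gamma(t)=-\nabla f(\gamma(t)),\ t>0,\qquad \gamma(0)=x_0,$$ converges (as $t\to+\infty$) and has finite length.
   Context: A function $f:\mathbb{R}^n\to\mathbb{R}$ is quasiconvex if for every $y\in\mathbb{R}$ the sublevel set $\{x : f(x)\le y\}$ is convex. It is coercive if $\lim_{\|x\|\to+\infty}f(x)=+\infty$. $C^{1,1}$ means that $f$ is $C^1$ and $\nabla f$ is Lipschitz continuous. The orbit is the maximal forward solution of the system; for coercive $f$ it is bounded and defined on $[0,+\infty)$. The length of a curve $\gamma:I\to\mathbb{R}^n$ is the supremum of $\sum_{i=1}^{k}\|\gamma(t_i)-\gamma(t_{i+1})\|$ over all finite subdivisions $t_1<\dots<t_{k+1}$ of $I$. *)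

(* Defs.v *)
From mathcomp Require Import all_boot all_order all_algebra.
From mathcomp Require Import all_classical all_reals all_analysis.

Set Implicit Arguments.
Unset Strict Implicit.
Unset Printing Implicit Defensive.

Import Order.TTheory GRing.Theory Num.Theory.
Import numFieldNormedType.Exports.

Local Open Scope classical_set_scope.
Local Open Scope ring_scope.

(* The library norm `|x| on 'rV[R]_n is the sup norm; it induces the usual
   topology, but lengths and gradients refer to the Euclidean structure. *)
Definition enorm (R : realType) (n : nat) (x : 'rV[R]_n) : R :=
  Num.sqrt (\sum_(i < n) x 0 i ^+ 2).

(* Meaningful where f is differentiable, as C11 below requires everywhere. *)
Definition gradient (R : realType) (n : nat) (f : 'rV[R]_n -> R)
    (x : 'rV[R]_n) : 'rV[R]_n :=
  \row_(i < n) 'D_(delta_mx 0 i) f x.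

Definition C1 (R : realType) (n : nat) (f : 'rV[R]_n -> R) : Prop :=
  (forall x, differentiable f x) /\ continuous (gradient f).

Definition C11 (R : realType) (n : nat) (f : 'rV[R]_n -> R) : Prop :=
  C1 f /\
  exists L : R, forall x y,
    enorm (gradient f x - gradient f y) <= L * enorm (x - y).

Definition quasiconvex (R : realType) (n : nat) (f : 'rV[R]_n -> R) : Prop :=
  forall y : R, convex_set [set x | f x <= y].

Definition coercive (R : realType) (n : nat) (f : 'rV[R]_n -> R) : Prop :=
  forall A : R, exists M : R, forall x, M <= enorm x -> A <= f x.

(* The time interval [0, T), where T may be +oo. *)
Definition forward_itv (R : realType) (T : \bar R) : set R :=
  [set t | 0 <= t /\ (t%:E < T)%E].

(* gamma is a total function; only its values on [0, T) matter. *)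
Definition forward_solution (R : realType) (n : nat) (f : 'rV[R]_n -> R)
    (x0 : 'rV[R]_n) (T : \bar R) (gamma : R -> 'rV[R]_n) : Prop :=
  [/\ (0 < T)%E,
      {within forward_itv T, continuous gamma},
      forall t : R, 0 < t -> (t%:E < T)%E ->
        is_derive t 1 gamma (- gradient f (gamma t))
    & gamma 0 = x0].

(* Maximality: no forward solution extends gamma beyond T. *)
Definition is_orbit (R : realType) (n : nat) (f : 'rV[R]_n -> R)
    (x0 : 'rV[R]_n) (T : \bar R) (gamma : R -> 'rV[R]_n) : Prop :=
  forward_solution f x0 T gamma /\
  forall (T' : \bar R) (gamma' : R -> 'rV[R]_n),
    forward_solution f x0 T' gamma' ->
    {in forward_itv T, gamma' =1 gamma} ->
    (T' <= T)%E.

Definition polygonal_length (R : realType) (n : nat) (gamma : R -> 'rV[R]_n)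
    (s : seq R) : R :=
  \sum_(0 <= i < (size s).-1) enorm (gamma s`_i - gamma s`_i.+1).

Definition curve_length (R : realType) (n : nat) (I : set R)
    (gamma : R -> 'rV[R]_n) : \bar R :=
  ereal_sup [set (polygonal_length gamma s)%:E |
             s in [set s : seq R | sorted <%R s /\ {in s, forall t, I t}]].

(* Main.v *)
Require Import Defs.
From mathcomp Require Import all_boot all_order all_algebra.
From mathcomp Require Import all_classical all_reals all_analysis.
From mathcomp Require Import ring lra.
Import Order.TTheory GRing.Theory Num.Theory.
Import numFieldNormedType.Exports.
Local Open Scope classical_set_scope.
Local Open Scope ring_scope.

(** Along a gradient orbit [f] decreases, so for [u <= t] the point [gamma t]
    lies in the convex sublevel set of [gamma u]; hence the gradient at
    [gamma u] makes a nonpositive product with [gamma t - gamma u]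
    ([quasiconvex_gradient_le0]), and [u |-> |gamma u - gamma t|] is
    nonincreasing on [[0, t]].  The orbit is thus self-contracted
    ([orbit_self_contracted]), and coercivity keeps it in a ball.

    A bounded self-contracted curve of the plane has finite length
    ([self_contracted_length_bounded]).  Fix a finite sequence of points on
    the curve and one of them, [p], followed by [q].  In a triangle formed by
    [p] and two later points, the side facing [p] is no longer than one of the
    other two, so the angle at [p] is acute.  All later points therefore lie in a quarter-plane
    with apex [p], and one of eight fixed directions makes an angle bounded
    away from a right angle with every vector of that quarter-plane
    ([acute_direction]).  Each later point being at distance at least
    [|p - q| / 2] from [p], the minimum, over [p] and the later points, of the
    scalar product with this direction grows by at least a fixed fraction of
    [|p - q|] when [p] is dropped.  These eight minima never decrease and are
    bounded, which bounds the sum of all the steps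
    ([self_contracted_length_le]).  Self-contractedness also gives convergence:
    once the orbit has come close to a cluster point, its distance to later
    points close to that same cluster point can only decrease
    ([self_contracted_cvg]).

    Since the gradient is globally Lipschitz, Picard iteration, measured with
    the weight [exp (- 2 K t)], contracts by one half on the whole half-line and
    yields a solution on [[0, +oo)] ([picard_lindelof]).  Solutions being unique
    ([forward_solution_unique]), a maximal one cannot stop earlier
    ([orbit_global]). *)

(** * Euclidean scalar product and norms *)

Definition dot {R : realType} {n : nat} (x y : 'rV[R]_n) : R :=
  \sum_(i < n) x 0 i * y 0 i.

Lemma dotC {R : realType} {n : nat} (x y : 'rV[R]_n) : dot x y = dot y x.
Proof. by apply: eq_bigr => i _; rewrite mulrC. Qed.

Lemma dotDl {R : realType} {n : nat} (x y z : 'rV[R]_n) :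
  dot (x + y) z = dot x z + dot y z.
Proof. by rewrite -big_split; apply: eq_bigr => i _; rewrite mxE mulrDl. Qed.

Lemma dotNl {R : realType} {n : nat} (x z : 'rV[R]_n) :
  dot (- x) z = - dot x z.
Proof. by rewrite -sumrN; apply: eq_bigr => i _; rewrite mxE mulNr. Qed.

Lemma dotBl {R : realType} {n : nat} (x y z : 'rV[R]_n) :
  dot (x - y) z = dot x z - dot y z.
Proof. by rewrite dotDl dotNl. Qed.

Lemma dotBr {R : realType} {n : nat} (x y z : 'rV[R]_n) :
  dot z (x - y) = dot z x - dot z y.
Proof. by rewrite dotC dotBl !(dotC z). Qed.

Lemma dot_ge0 {R : realType} {n : nat} (x : 'rV[R]_n) : 0 <= dot x x.
Proof. by apply: sumr_ge0 => i _; rewrite -expr2 sqr_ge0. Qed.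

Lemma enorm_ge0 {R : realType} {n : nat} (x : 'rV[R]_n) : 0 <= enorm x.
Proof. exact: sqrtr_ge0. Qed.

Lemma sqr_enorm {R : realType} {n : nat} (x : 'rV[R]_n) :
  enorm x ^+ 2 = dot x x.
Proof.
rewrite sqr_sqrtr; first by apply: eq_bigr => i _; rewrite expr2.
by apply: sumr_ge0 => i _; rewrite sqr_ge0.
Qed.

Lemma enormE {R : realType} {n : nat} (x : 'rV[R]_n) :
  enorm x = Num.sqrt (dot x x).
Proof. by rewrite -sqr_enorm sqrtr_sqr ger0_norm ?enorm_ge0. Qed.

Lemma enorm_distC {R : realType} {n : nat} (x y : 'rV[R]_n) :
  enorm (x - y) = enorm (y - x).
Proof. by rewrite !enormE !dotBl !dotBr (dotC x y); congr Num.sqrt; ring. Qed.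

Lemma coord_le_norm {R : realType} {n : nat} (x : 'rV[R]_n) i :
  `|x 0 i| <= `|x|.
Proof.
rewrite [leRHS]/Num.Def.normr/= mx_normrE.
exact: (le_bigmax _ (fun k : 'I_1 * 'I_n => `|x k.1 k.2|) (0, i)).
Qed.

Lemma norm_le_coord {R : realType} {n : nat} (x : 'rV[R]_n) e :
  0 <= e -> (forall i, `|x 0 i| <= e) -> `|x| <= e.
Proof.
move=> e0 xe; rewrite [leLHS]/Num.Def.normr/= mx_normrE.
by apply: bigmax_le => // -[i j] _ /=; rewrite (ord1 i).
Qed.

Lemma norm_le_enorm {R : realType} {n : nat} (x : 'rV[R]_n) : `|x| <= enorm x.
Proof.
apply: norm_le_coord (enorm_ge0 _) _ => i.
rewrite -sqrtr_sqr ler_wsqrtr// (bigD1 i)//= lerDl.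
by apply: sumr_ge0 => j _; rewrite sqr_ge0.
Qed.

Lemma enorm_le_norm {R : realType} {n : nat} (x : 'rV[R]_n) :
  enorm x <= Num.sqrt n%:R * `|x|.
Proof.
rewrite -[`|x|]ger0_norm// -sqrtr_sqr -sqrtrM// ler_wsqrtr//.
rewrite -[n in n%:R]card_ord -sumr_const mulr_suml.
apply: ler_sum => i _; rewrite mul1r -[leLHS]real_normK ?num_real//.
by rewrite lerXn2r ?nnegrE// coord_le_norm.
Qed.

(** * Plane vectors in acute position *)

Lemma sum_ord2 {R : realType} (F : 'I_2 -> R) : \sum_(i < 2) F i = F 0 + F 1.
Proof.
rewrite big_ord_recl big_ord1; congr (_ + F _); exact/val_inj.
Qed.

Lemma dot2E {R : realType} (x y : 'rV[R]_2) :
  dot x y = x 0 0 * y 0 0 + x 0 1 * y 0 1.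
Proof. exact: sum_ord2. Qed.

(** The eight vectors [(+-1, +-2)] and [(+-2, +-1)]: consecutive ones are less
    than 60 degrees apart, so that every quarter-plane contains one of them well
    inside. *)
Definition direction {R : realType} (k : bool * bool * bool) : 'rV[R]_2 :=
  let: (swap, sx, sy) := k in
  let x := (-1) ^+ sx * (if swap then 2 else 1) in
  let y := (-1) ^+ sy * (if swap then 1 else 2) in
  \row_(i < 2) (if i == 0 then x else y).

Definition cross {R : realType} (x y : 'rV[R]_2) : R :=
  x 0 0 * y 0 1 - x 0 1 * y 0 0.

Lemma row2_eq0 {R : realType} (x : 'rV[R]_2) :
  x 0 0 = 0 -> x 0 1 = 0 -> x = 0.
Proof.
move=> x0 x1; apply/rowP => i; rewrite mxE.
by case: i => -[|[|//]] i2; [rewrite -[RHS]x0|rewrite -[RHS]x1];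
  congr (x 0 _); exact/val_inj.
Qed.

Lemma dot2_gt0 {R : realType} (x : 'rV[R]_2) : x != 0 -> 0 < dot x x.
Proof.
move=> x0; rewrite lt_neqAle dot_ge0 andbT; apply: contra_neq x0 => /esym.
rewrite dot2E => H.
have := sqr_ge0 (x 0 0); have := sqr_ge0 (x 0 1).
by move=> h1 h2; apply: row2_eq0; apply/eqP; rewrite -sqrf_eq0; apply/eqP; lra.
Qed.

(** Vectors with nonnegative scalar products lie in a half-plane, where [cross]
    orders their directions; a first one in this order exists by induction,
    since for such vectors, [m] being nonzero, [cross m v < 0] and
    [0 <= cross m w] force [0 <= cross v w]. *)
Lemma clockwise_most {R : realType} (s : seq 'rV[R]_2) :
  {in s &, forall v w, 0 <= dot v w} ->
  (forall v, v \in s -> v = 0) \/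
  exists m, [/\ m \in s, m != 0 & forall v, v \in s -> 0 <= cross m v].
Proof.
elim: s => [|v s IH] acute; first by left.
have acute' : {in s &, forall x y, 0 <= dot x y}.
  by move=> x y xs ys; apply: acute; rewrite inE ?xs ?ys orbT.
have [->|v0] := eqVneq v 0.
  case: (IH acute') => [s0|[m [ms m0 cm]]].
    by left=> w; rewrite inE => /predU1P[//|/s0].
  right; exists m; split=> //; first by rewrite inE ms orbT.
  move=> w; rewrite inE => /predU1P[->|/cm//].
  by rewrite /cross !mxE !mulr0 subrr.
case: (IH acute') => [s0|[m [ms m0 cm]]].
  right; exists v; split=> //; first by rewrite mem_head.
  move=> w; rewrite inE => /predU1P[->|/s0->]; rewrite /cross ?mxE; lra.
right; have [cmv|cmv] := leP 0 (cross m v).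
  exists m; split=> //; first by rewrite inE ms orbT.
  by move=> w; rewrite inE => /predU1P[->//|/cm].
exists v; split=> //; first by rewrite mem_head.
move=> w; rewrite inE => /predU1P[->|ws]; first by rewrite /cross; lra.
have mm := dot2_gt0 _ m0.
rewrite -(pmulr_rge0 _ mm).
have -> : dot m m * cross v w = dot m v * cross m w - cross m v * dot m w.
  by rewrite !dot2E /cross; ring.
have mv : 0 <= dot m v by apply: acute; rewrite inE ?ms ?eqxx ?orbT.
have mw : 0 <= dot m w by apply: acute; rewrite inE ?ms ?ws ?orbT.
rewrite -mulNr addr_ge0// mulr_ge0// ?cm//; lra.
Qed.

(** Some direction is turned counterclockwise from [m] by an angle bounded away
    from both 0 and a right angle; the four bounds express this without
    trigonometry. *)
Lemma direction_ahead {R : realType} (m : 'rV[R]_2) :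
  exists k, (`|m 0 0| <= dot (direction k) m /\ `|m 0 1| <= dot (direction k) m)
    /\ (`|m 0 0| <= cross m (direction k) /\ `|m 0 1| <= cross m (direction k)).
Proof.
suff [k hk] : exists k : bool * bool * bool,
    let x : R := (-1) ^+ k.1.2 * (if k.1.1 then 2 else 1) in
    let y := (-1) ^+ k.2 * (if k.1.1 then 1 else 2) in
    (`|m 0 0| <= x * m 0 0 + y * m 0 1 /\ `|m 0 1| <= x * m 0 0 + y * m 0 1) /\
    (`|m 0 0| <= m 0 0 * y - m 0 1 * x /\ `|m 0 1| <= m 0 0 * y - m 0 1 * x).
  by exists k; rewrite dot2E /cross; case: k hk => [[swap sx] sy]; rewrite !mxE.
move: (m 0 0) (m 0 1) => p q.
(* One direction for each of the eight octants that [m] may point into. *)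
have [p0|p0] := leP 0 p; have [q0|q0] := leP 0 q.
- rewrite (ger0_norm p0) (ger0_norm q0); have [pq|pq] := leP q p.
    by exists (false, false, false) => /=; rewrite ?expr0 ?expr1; split; split; lra.
  by exists (false, true, false) => /=; rewrite ?expr0 ?expr1; split; split; lra.
- rewrite (ger0_norm p0) (ltr0_norm q0); have [pq|pq] := leP (- q) p.
    by exists (true, false, false) => /=; rewrite ?expr0 ?expr1; split; split; lra.
  by exists (true, false, true) => /=; rewrite ?expr0 ?expr1; split; split; lra.
- rewrite (ltr0_norm p0) (ger0_norm q0); have [pq|pq] := leP (- p) q.
    by exists (true, true, false) => /=; rewrite ?expr0 ?expr1; split; split; lra.
  by exists (true, true, true) => /=; rewrite ?expr0 ?expr1; split; split; lra.
- rewrite (ltr0_norm p0) (ltr0_norm q0); have [pq|pq] := leP p q.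
    by exists (false, true, true) => /=; rewrite ?expr0 ?expr1; split; split; lra.
  by exists (false, false, true) => /=; rewrite ?expr0 ?expr1; split; split; lra.
Qed.

(** The hypotheses put [v] in the quarter-plane counterclockwise from [m].  In
    the basis of [m] and its quarter turn, [v] and a direction well inside that
    quarter-plane have nonnegative coordinates, those of the direction being not
    too small, so no cancellation occurs in their scalar product. *)
Lemma quadrant_direction {R : realType} (m : 'rV[R]_2) : m != 0 ->
  exists k, forall v, 0 <= dot m v -> 0 <= cross m v ->
    `|v| <= dot (direction k) v.
Proof.
move=> m0; have [k [[h1 h2] [h3 h4]]] := direction_ahead m.
exists k => v s0 t0; have mm := dot2_gt0 _ m0.
set u : 'rV[R]_2 := direction k in h1 h2 h3 h4 *.
(* [dot m m *: v] and [dot m m * dot u v] expanded in the orthogonal basis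
   formed by [m] and [m] turned by a right angle. *)
have e : dot m m * dot u v = dot m v * dot u m + cross m v * cross m u.
  by rewrite !dot2E /cross; ring.
have e0 : dot m m * v 0 0 = dot m v * m 0 0 - cross m v * m 0 1.
  by rewrite !dot2E /cross; ring.
have e1 : dot m m * v 0 1 = dot m v * m 0 1 + cross m v * m 0 0.
  by rewrite !dot2E /cross; ring.
have vu0 : `|v 0 0| <= dot u v.
  rewrite -(ler_pM2l mm) -{1}(gtr0_norm mm) -normrM e0 e.
  apply: le_trans (ler_normB _ _) _.
  by rewrite !normrM !(ger0_norm s0) !(ger0_norm t0) lerD// ler_wpM2l.
have vu1 : `|v 0 1| <= dot u v.
  rewrite -(ler_pM2l mm) -{1}(gtr0_norm mm) -normrM e1 e.
  apply: le_trans (ler_normD _ _) _.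
  by rewrite !normrM !(ger0_norm s0) !(ger0_norm t0) lerD// ler_wpM2l.
apply: norm_le_coord (le_trans _ vu0) _ => // -[[|[|//]] i2].
  by rewrite (_ : Ordinal i2 = 0)//; exact/val_inj.
by rewrite (_ : Ordinal i2 = 1)//; exact/val_inj.
Qed.

(** Vectors with nonnegative scalar products fill at most the quarter-plane that
    starts at their clockwise-most member. *)
Lemma acute_direction {R : realType} (s : seq 'rV[R]_2) :
  {in s &, forall v w, 0 <= dot v w} ->
  exists k, forall v, v \in s -> `|v| <= dot (direction k) v.
Proof.
move=> acute; have [s0|[m [ms m0 cm]]] := clockwise_most _ acute.
  exists (true, true, true) => v /s0 ->.
  by rewrite normr0 dot2E !mxE !mulr0 addr0.
have [k hk] := quadrant_direction m m0.
by exists k => v vs; apply: hk; [exact: acute|exact: cm].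
Qed.

(** * Length of self-contracted plane curves *)

Definition self_contracted {R : realType} {n : nat} (I : set R)
    (gamma : R -> 'rV[R]_n) :=
  forall r s t, I r -> I s -> I t -> r <= s -> s <= t ->
    enorm (gamma s - gamma t) <= enorm (gamma r - gamma t).

(** In the triangle [0], [x], [y], a side [x - y] no longer than [y] forces an
    acute angle at [0], with a quantitative bound. *)
Lemma enorm_le_dot {R : realType} {n : nat} (x y : 'rV[R]_n) :
  enorm (x - y) <= enorm y -> dot x x <= 2 * dot x y.
Proof.
move=> h; have : enorm (x - y) ^+ 2 <= enorm y ^+ 2.
  by rewrite lerXn2r ?nnegrE ?enorm_ge0.
rewrite !sqr_enorm dotBl !dotBr (dotC y x); lra.
Qed.

Lemma polygonal_length_cons {R : realType} {n : nat} (gamma : R -> 'rV[R]_n)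
    t r s :
  polygonal_length gamma [:: t, r & s] =
  enorm (gamma t - gamma r) + polygonal_length gamma (r :: s).
Proof. by rewrite /polygonal_length /= big_nat_recl. Qed.

(** The hypothesis puts [v] beyond the perpendicular bisector of [0] and [w];
    the constant 4 absorbs the comparison between the sup norm of [v] and the
    Euclidean norm of [w]. *)
Lemma half_plane {R : realType} (v w : 'rV[R]_2) :
  dot w w <= 2 * dot w v -> enorm w <= 4 * `|v|.
Proof.
rewrite !dot2E => h.
have hw : enorm w <= `|w 0 0| + `|w 0 1|.
  rewrite -[leRHS]ger0_norm ?addr_ge0// -sqrtr_sqr ler_wsqrtr//.
  rewrite sum_ord2 -[w 0 0 ^+ 2]real_normK ?num_real//.
  rewrite -[w 0 1 ^+ 2]real_normK ?num_real//.
  by rewrite sqrrD lerD2r lerDl mulrn_wge0// mulr_ge0.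
apply: le_trans hw _.
have h0 : w 0 0 * v 0 0 <= `|w 0 0| * `|v|.
  by apply: le_trans (ler_norm _) _; rewrite normrM ler_wpM2l// coord_le_norm.
have h1 : w 0 1 * v 0 1 <= `|w 0 1| * `|v|.
  by apply: le_trans (ler_norm _) _; rewrite normrM ler_wpM2l// coord_le_norm.
have n0 : w 0 0 * w 0 0 = `|w 0 0| * `|w 0 0|.
  by rewrite -normrM ger0_norm// -expr2 sqr_ge0.
have n1 : w 0 1 * w 0 1 = `|w 0 1| * `|w 0 1|.
  by rewrite -normrM ger0_norm// -expr2 sqr_ge0.
rewrite n0 n1 in h.
have := normr_ge0 (w 0 0); have := normr_ge0 (w 0 1); have := normr_ge0 v.
move: (`|w 0 0|) (`|w 0 1|) (`|v|) h h0 h1 => a b c h h0 h1 c0 b0 a0.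
have ab : (a + b) * (a + b) <= (4 * c) * (a + b).
  have := sqr_ge0 (a - b); rewrite expr2 => hab; nra.
have [ab0|ab0] := ltP 0 (a + b); first by rewrite ler_pM2r in ab.
by apply: le_trans ab0 _; lra.
Qed.

(** Each step is paid for by one of the eight directions, along which a lower
    bound valid for all the remaining points rises by a quarter of the step.
    Quantifying over arbitrary lower bounds [b], instead of taking minima, lets
    the induction hypothesis be applied to the raised bounds. *)
Lemma self_contracted_length_le {R : realType} (I : set R)
    (gamma : R -> 'rV[R]_2) :
  self_contracted I gamma ->
  forall s t (b : bool * bool * bool -> R), path <%R t s ->
  (forall r, r \in t :: s -> I r) ->
  (forall k r, r \in t :: s -> b k <= dot (direction k) (gamma r)) ->
  polygonal_length gamma (t :: s) <=
  4 * \sum_k (dot (direction k) (gamma (last t s)) - b k).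
Proof.
move=> sc; elim=> [|t' s IH] t b.
  move=> _ _ bt; rewrite /polygonal_length/= big_geq// mulr_ge0//.
  apply: sumr_ge0 => k _.
  by rewrite subr_ge0 bt ?mem_head.
move=> /[dup] tp; rewrite /= => /andP[tt' pt'] It bt.
have It0 : I t by apply: It; rewrite mem_head.
have It's r : r \in t' :: s -> I r by move=> rs; apply: It; rewrite inE rs orbT.
have lt_t r : r \in t' :: s -> t < r.
  rewrite inE => /predU1P[->//|rs]; apply: lt_trans tt' _.
  exact: (allP (order_path_min lt_trans pt')).
have le_t' r : r \in t' :: s -> t' <= r.
  rewrite inE => /predU1P[->//|rs]; apply: ltW.
  exact: (allP (order_path_min lt_trans pt')).
have scd r r' : r \in t' :: s -> r' \in t' :: s -> r <= r' ->
    dot (gamma r - gamma t) (gamma r - gamma t) <=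
      2 * dot (gamma r - gamma t) (gamma r' - gamma t).
  move=> rs r's rr'; apply: enorm_le_dot.
  rewrite opprB addrA subrK.
  rewrite (enorm_distC (gamma r')).
  exact: (sc t r r' It0 (It's _ rs) (It's _ r's) (ltW (lt_t _ rs)) rr').
have [k hk] : exists k, forall v,
    v \in [seq gamma r - gamma t | r <- t' :: s] -> `|v| <= dot (direction k) v.
  apply: acute_direction => v w /mapP[r rs ->] /mapP[r' r's ->].
  have [rr'|/ltW rr'] := leP r r'.
    have := scd r r' rs r's rr'; have := dot_ge0 (gamma r - gamma t); lra.
  have := scd r' r r's rs rr'; have := dot_ge0 (gamma r' - gamma t).
  rewrite (dotC (gamma r - _)); lra.
pose d := enorm (gamma t - gamma t') / 4.
(* The direction [k] gains at least [d] when [gamma t] is dropped. *)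
pose b' k' := b k' + (if k' == k then d else 0).
have := IH t' b' pt' It's.
have hb' : forall k' r, r \in t' :: s -> b' k' <= dot (direction k') (gamma r).
  move=> k' r rs; rewrite /b'; case: eqVneq => [->|_].
    have /= hr := hk _ (map_f _ rs); rewrite dotBr in hr.
    have := bt k t (mem_head _ _).
    have hd : d <= `|gamma r - gamma t|.
      rewrite /d ler_pdivrMr// mulrC enorm_distC half_plane//.
      by apply: scd => //; [exact: mem_head|exact: le_t'].
    lra.
  by rewrite addr0 bt// inE rs orbT.
move=> /(_ hb'); rewrite polygonal_length_cons.
have -> : \sum_k0 (dot (direction k0) (gamma (last t' s)) - b' k0) =
  \sum_k0 (dot (direction k0) (gamma (last t' s)) - b k0) - d.
  rewrite (bigD1 k)//= [in RHS](bigD1 k)//= {1}/b' eqxx.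
  under eq_bigr => k0 /negPf k0k do rewrite /b' k0k addr0.
  by ring.
rewrite /d; lra.
Qed.

(** There are 8 directions, along each of which the curve spans at most [6 * B];
    each unit of gain pays for a length 4, hence 192. *)
Lemma self_contracted_length_bounded {R : realType} (I : set R)
    (gamma : R -> 'rV[R]_2) B :
  self_contracted I gamma -> 0 <= B -> (forall t, I t -> `|gamma t| <= B) ->
  (curve_length I gamma <= (192 * B)%:E)%E.
Proof.
move=> sc B0 gB; apply: ge_ereal_sup => _ [s [ss sI] <-]; rewrite lee_fin.
case: s ss sI => [_ _|t s ts sI].
  by rewrite /polygonal_length big_geq// mulr_ge0.
have dB k r : r \in t :: s -> `|dot (direction k) (gamma r)| <= 3 * B.
  move=> /sI/gB gr; rewrite dot2E.
  have g0 := le_trans (coord_le_norm (gamma r) 0) gr.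
  have g1 := le_trans (coord_le_norm (gamma r) 1) gr.
  apply: le_trans (ler_normD _ _) _; rewrite !normrM.
  case: k => [[a b] c]; rewrite !mxE/= !normrMsign.
  by case: a; rewrite ?normr1 ?(ger0_norm (ler0n R 2)); lra.
apply: le_trans
  (self_contracted_length_le _ _ sc s t (fun=> - (3 * B)) ts sI _) _.
  by move=> k r /(dB k); rewrite ler_norml => /andP[].
have : \sum_(k : bool * bool * bool)
      (dot (direction k) (gamma (last t s)) - - (3 * B)) <=
    \sum_(k : bool * bool * bool) (6 * B).
  apply: ler_sum => k _; have := dB k _ (mem_last _ _).
  by rewrite ler_norml => /andP[]; lra.
rewrite sumr_const !card_prod card_bool -mulr_natl; lra.
Qed.

(** * Derivatives along a curve *)

(** Comparing only the endpoints, with no derivative required there, suits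
    solutions that are merely continuous at time 0. *)
Lemma derive_le0_nonincreasing {R : realType} (g dg : R -> R) (a b : R) :
  a <= b -> {within `[a, b], continuous g} ->
  (forall x, a < x < b -> is_derive x 1 g (dg x)) ->
  (forall x, a < x < b -> dg x <= 0) -> g b <= g a.
Proof.
rewrite le_eqVlt => /predU1P[->//|ab] cg dgP dg0.
have dgP' x : x \in `]a, b[%R -> is_derive x 1 g (dg x).
  by rewrite in_itv/=; exact: dgP.
have [c cab] := MVT ab dgP' cg.
move=> e; rewrite -subr_le0 e.
by apply: mulr_le0_ge0; [apply: dg0; rewrite in_itv/= in cab|lra].
Qed.

Lemma is_derive_coord {R : realType} {n : nat} (gamma : R -> 'rV[R]_n) (t : R)
    (v : 'rV[R]_n) i :
  is_derive t 1 gamma v -> is_derive t 1 (fun s => gamma s 0 i) (v 0 i).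
Proof.
move=> [dg gv]; split; first by move/derivable_mxP : dg; exact.
by rewrite -gv derive_mx// mxE.
Qed.

Lemma is_derive_rV {R : realType} {n : nat} (gamma : R -> 'rV[R]_n) (t : R)
    (v : 'rV[R]_n) :
  (forall i, is_derive t 1 (fun s => gamma s 0 i) (v 0 i)) ->
  is_derive t 1 gamma v.
Proof.
move=> d; have dg : derivable gamma t 1.
  by apply/derivable_mxP => i j; rewrite (ord1 i); case: (d j).
split => //; rewrite derive_mx//; apply/rowP => i; rewrite mxE.
by case: (d i).
Qed.

Lemma is_derive_dot {R : realType} {n : nat} (x y : R -> 'rV[R]_n) (t : R)
    (u v : 'rV[R]_n) :
  is_derive t 1 x u -> is_derive t 1 y v ->
  is_derive t 1 (fun s => dot (x s) (y s)) (dot u (y t) + dot (x t) v).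
Proof.
move=> dx dy.
have -> : (fun s => dot (x s) (y s)) = \sum_(i < n) (fun s => x s 0 i * y s 0 i).
  by apply/funext => s; rewrite fct_sumE.
have -> : dot u (y t) + dot (x t) v =
    \sum_(i < n) (x t 0 i *: v 0 i + y t 0 i *: u 0 i).
  rewrite /dot -big_split; apply: eq_bigr => i _ /=.
  by rewrite addrC [_ *: u _ _]mulrC.
apply: is_derive_sum => i.
exact: (is_deriveM (is_derive_coord x t u i dx) (is_derive_coord y t v i dy)).
Qed.

Lemma diff_gradient {R : realType} {n : nat} (f : 'rV[R]_n -> R) x v :
  differentiable f x -> 'd f x v = dot (gradient f x) v.
Proof.
move=> df.
have {1}-> : v = \sum_(i < n) v 0 i *: delta_mx 0 i by exact: row_sum_delta.
rewrite linear_sum; apply: eq_bigr => i _.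
by rewrite linearZ/= mxE deriveE// mulrC.
Qed.

Lemma is_derive_comp_gradient {R : realType} {n : nat} (f : 'rV[R]_n -> R)
    (gamma : R -> 'rV[R]_n) (t : R) (v : 'rV[R]_n) :
  differentiable f (gamma t) -> is_derive t 1 gamma v ->
  is_derive t 1 (f \o gamma) (dot (gradient f (gamma t)) v).
Proof.
move=> df [dg gv].
have dg' : differentiable gamma t by apply/derivable1_diffP.
have dfg : differentiable (f \o gamma) t by exact: differentiable_comp.
split; first by apply/derivable1_diffP.
have dgv : 'd gamma t 1 = v by rewrite -deriveE.
by rewrite deriveE// diff_comp//= dgv diff_gradient.
Qed.

(** The segment from [x] to [y] stays in the sublevel set of [f x], so the right
    difference quotients of [f] along it are nonpositive. *)
Lemma quasiconvex_gradient_le0 {R : realType} {n : nat} (f : 'rV[R]_n -> R) x y :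
  quasiconvex f -> differentiable f x -> f y <= f x ->
  dot (gradient f x) (y - x) <= 0.
Proof.
move=> qf df yx; rewrite -diff_gradient// -deriveE//.
have fc h : 0 <= h -> h <= 1 -> f (h *: (y - x) + x) <= f x.
  move=> h0 h1; have := qf (f x) y x (Itv01 h0 h1).
  rewrite !inE => /(_ yx (lexx _)).
  congr (is_true (f _ <= _)); rewrite /conv/=.
  by rewrite /unstable.onem scalerBr scalerBl scale1r -addrA [- _ + x]addrC.
have dfx : derivable f x (y - x) by exact: diff_derivable.
have right_limit :
    h^-1 *: (f (h *: (y - x) + x) - f x) @[h --> 0^'+] --> 'D_(y - x) f x.
  apply: cvg_trans dfx; apply: cvg_app.
  by apply: within_subset => h /= h0; rewrite gt_eqF.
apply: (cvgr_to_le right_limit); near=> k.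
have k0 : 0 <= k by [].
have k1 : k <= 1 by near: k; exact: nbhs_right_le.
by apply: mulr_ge0_le0; rewrite ?invr_ge0// subr_le0 fc.
Unshelve. all: by end_near. Qed.

(** * Gradient orbits of quasiconvex functions *)

Lemma dot_self_continuous {R : realType} {n : nat} :
  continuous (fun x : 'rV[R]_n => dot x x).
Proof.
move=> x.
have -> : (fun x => dot x x) = \sum_(i < n) (fun x : 'rV[R]_n => x 0 i * x 0 i).
  by apply/funext => y; rewrite fct_sumE.
apply: (big_ind (fun g : 'rV[R]_n -> R => {for x, continuous g})).
- exact: cst_continuous.
- by move=> g h cg ch; exact: (continuousD cg ch).
- by move=> i _; apply: continuousM; exact: coord_continuous.
Qed.

Lemma forward_within {R : realType} {n : nat} (f : 'rV[R]_n -> R) x0 T gamma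
    (a b : R) :
  forward_solution f x0 T gamma -> 0 <= a -> (b%:E < T)%E ->
  {within `[a, b], continuous gamma}.
Proof.
move=> [_ cg _ _] a0 bT; apply: continuous_subspaceW cg => t /=.
rewrite in_itv/= => /andP[at_ tb]; split; first exact: le_trans at_.
by apply: le_lt_trans bT; rewrite lee_fin.
Qed.

Lemma forward_is_derive {R : realType} {n : nat} (f : 'rV[R]_n -> R) x0 T gamma
    (a b t : R) :
  forward_solution f x0 T gamma -> 0 <= a -> (b%:E < T)%E -> a < t < b ->
  is_derive t 1 gamma (- gradient f (gamma t)).
Proof.
move=> [_ _ dg _] a0 bT /andP[at_ tb]; apply: dg; first exact: le_lt_trans at_.
by apply: lt_trans bT; rewrite lte_fin.
Qed.

Lemma orbit_descent {R : realType} {n : nat} (f : 'rV[R]_n -> R) x0 T gamma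
    (a b : R) :
  (forall x, differentiable f x) -> forward_solution f x0 T gamma ->
  0 <= a -> a <= b -> (b%:E < T)%E -> f (gamma b) <= f (gamma a).
Proof.
move=> df sol a0 ab bT.
apply: (derive_le0_nonincreasing (f \o gamma)
  (fun t => dot (gradient f (gamma t)) (- gradient f (gamma t))) _ _ ab).
- apply: within_continuous_comp; last exact: (forward_within _ _ _ _ _ _ sol).
  by move=> x _; apply/differentiable_continuous.
- move=> t tab; apply: is_derive_comp_gradient => //.
  exact: (forward_is_derive _ _ _ _ _ _ _ sol a0 bT).
- by move=> t _; rewrite dotC dotNl oppr_le0 dot_ge0.
Qed.

(** Half the derivative of [|gamma u - gamma t| ^ 2] is
    [dot (gradient f (gamma u)) (gamma t - gamma u)], and [gamma t] lies in the
    sublevel set of [f (gamma u)]. *)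
Lemma orbit_self_contracted {R : realType} {n : nat} (f : 'rV[R]_n -> R) x0 T
    gamma :
  (forall x, differentiable f x) -> quasiconvex f ->
  forward_solution f x0 T gamma -> self_contracted (forward_itv T) gamma.
Proof.
move=> df qf sol r s t [r0 _] [_ sT] [_ tT] rs st.
rewrite !enormE ler_wsqrtr//.
pose z u := gamma u - gamma t.
apply: (derive_le0_nonincreasing (fun u => dot (z u) (z u))
  (fun u => dot (- gradient f (gamma u)) (z u) +
            dot (z u) (- gradient f (gamma u))) _ _ rs).
- apply: (within_continuous_comp _ z (fun x => dot x x)).
    by move=> x _; exact: dot_self_continuous.
  apply: within_continuousB; first exact: (forward_within _ _ _ _ _ _ sol).
  by move=> x; exact: cvg_cst.
- move=> u urs.
  have dz : is_derive u 1 z (- gradient f (gamma u)).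
    have := is_deriveB (forward_is_derive _ _ _ _ _ _ _ sol r0 sT urs)
      (is_derive_cst (gamma t) u (1 : R)).
    by rewrite subr0.
  exact: is_derive_dot.
- move=> u /andP[ru us]; rewrite (dotC (z u)) -mulr2n mulrn_wle0//.
  rewrite dotNl -dotC -dotNl opprB dotC.
  apply: quasiconvex_gradient_le0 => //.
  apply: (orbit_descent _ _ _ _ _ _ df sol) => //; first by lra.
  lra.
Qed.

Lemma coercive_orbit_bounded {R : realType} {n : nat} (f : 'rV[R]_n -> R) x0 T
    gamma :
  (forall x, differentiable f x) -> coercive f ->
  forward_solution f x0 T gamma ->
  exists2 B, 0 <= B & forall t, forward_itv T t -> `|gamma t| <= B.
Proof.
move=> df cf sol; have [M HM] := cf (f x0 + 1).
have gM t : forward_itv T t -> enorm (gamma t) <= M.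
  move=> [t0 tT]; rewrite leNgt; apply/negP => /ltW/HM.
  have := orbit_descent _ _ _ _ _ _ df sol (lexx 0) t0 tT.
  by have [_ _ _ ->] := sol; lra.
exists M.
  have [T0 _ _ _] := sol.
  exact: le_trans (enorm_ge0 _) (gM 0 (conj (lexx 0) T0)).
by move=> t /gM; exact: le_trans (norm_le_enorm _).
Qed.

(** The orbit has a cluster point [p] by compactness.  Pick [s] with [gamma s]
    close to [p]; for [t >= s] pick [u >= t] with [gamma u] close to [p]: then
    [gamma t] is no farther from [gamma u] than [gamma s] is. *)
Lemma self_contracted_cvg {R : realType} {n : nat} (gamma : R -> 'rV[R]_n) B :
  self_contracted (forward_itv +oo%E) gamma ->
  (forall t, forward_itv +oo%E t -> `|gamma t| <= B) ->
  cvg (gamma t @[t --> +oo]).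
Proof.
move=> sc gB.
have fwd (t : R) : 0 <= t -> forward_itv +oo%E t.
  by move=> t0; split=> //; exact: ltry.
have cB : compact [set x : 'rV[R]_n | `|x| <= B].
  apply: bounded_closed_compact.
    exists B; split; first exact: num_real.
    by move=> M BM x /= xB; exact/(le_trans xB)/ltW.
  have -> : [set x : 'rV[R]_n | `|x| <= B] =
      Num.Def.normr @^-1` [set r | r <= B] by [].
  by apply: closed_comp => [x _|]; [exact: norm_continuous|exact: closed_le].
have gK : (gamma t @[t --> +oo]) [set x : 'rV[R]_n | `|x| <= B].
  by exists 0; split=> // t t0; apply: gB; apply: fwd; exact: ltW.
have [p [_ clp]] := cB _ _ gK.
apply/cvg_ex; exists p; apply/cvgrPdist_le => e e0.
(* Two points within [d] of the cluster point are at Euclidean distance at most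
   [sqrt n * (2 * d)], and [gamma t] is no farther than that from the second. *)
pose d := e / (1 + 2 * Num.sqrt n%:R).
have sn := sqrtr_ge0 (n%:R : R).
have d0 : 0 < d by rewrite divr_gt0//; lra.
have late a : 0 <= a -> exists2 s, a <= s & `|p - gamma s| <= d.
  move=> a0.
  have [] := clp [set gamma s | s in [set s | a < s]] (ball p d).
  - by exists a; split => //= t ta; exists t.
  - exact: nbhsx_ballx.
  - move=> _ [[s /= /ltW as_ <-]].
    by rewrite -ball_normE/= => /ltW sd; exists s.
have [s s0 sd] := late 0 (lexx 0).
exists s; split=> [|t /ltW st]; first exact: num_real.
have t0 := le_trans s0 st.
have [u tu ud] := late t t0.
have u0 := le_trans t0 tu.
have := sc s t u (fwd s s0) (fwd t t0) (fwd u u0) st tu => tsu.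
have su : enorm (gamma s - gamma u) <= Num.sqrt n%:R * (2 * d).
  apply: le_trans (enorm_le_norm _) _; rewrite ler_wpM2l//.
  rewrite -(subrKA p); apply: le_trans (ler_normD _ _) _.
  by rewrite distrC; lra.
have tu' := le_trans (norm_le_enorm _) (le_trans tsu su).
have -> : p - gamma t = (p - gamma u) - (gamma t - gamma u).
  by rewrite opprB addrA subrK.
apply: le_trans (ler_normB _ _) _; apply: le_trans (lerD ud tu') _.
by rewrite /d le_eqVlt; apply/orP; left; apply/eqP; field; lra.
Qed.

(** * Uniqueness of solutions *)

Lemma is_derive_expR_scale {R : realType} (c t : R) :
  is_derive t 1 (fun s => expR (c * s)) (c * expR (c * t)).
Proof.
have d : is_derive t 1 (fun s : R => c * s) c.
  have := is_deriveZ c (is_derive_id t (1 : R)).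
  by rewrite [_ *: _]mulr1.
have := is_derive1_comp (is_derive_expR (c * t)) d.
by rewrite mulrC.
Qed.

Lemma expR_scale_continuous {R : realType} (c : R) :
  continuous (fun s : R => expR (c * s)).
Proof.
move=> t; apply/differentiable_continuous/derivable1_diffP.
by case: (is_derive_expR_scale c t).
Qed.

Lemma dot_twice_le {R : realType} {n : nat} (x y : 'rV[R]_n) :
  2 * dot x y <= dot x x + dot y y.
Proof. by have := dot_ge0 (x - y); rewrite dotBl !dotBr (dotC y); lra. Qed.

(** Gronwall: the squared distance [w] of two solutions satisfies
    [w' <= (1 + L ^ 2) w], so [exp (- (1 + L ^ 2) t) * w t] is nonincreasing, and
    it vanishes at 0. *)
Lemma forward_solution_unique {R : realType} {n : nat} (f : 'rV[R]_n -> R)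
    x0 T1 T2 g1 g2 L :
  (forall x y, enorm (gradient f x - gradient f y) <= L * enorm (x - y)) ->
  forward_solution f x0 T1 g1 -> forward_solution f x0 T2 g2 ->
  forall t, 0 <= t -> (t%:E < T1)%E -> (t%:E < T2)%E -> g1 t = g2 t.
Proof.
move=> lip sol1 sol2 t t0 tT1 tT2.
pose z u := g1 u - g2 u.
pose dz u := - gradient f (g1 u) - - gradient f (g2 u).
pose c := - (1 + L ^+ 2).
have z0 : z 0 = 0.
  by rewrite /z; case: sol1 sol2 => _ _ _ -> [_ _ _ ->]; rewrite subrr.
have : expR (c * t) * dot (z t) (z t) <= expR (c * 0) * dot (z 0) (z 0).
  apply: (derive_le0_nonincreasing (fun u => expR (c * u) * dot (z u) (z u))
    (fun u => expR (c * u) * (dot (dz u) (z u) + dot (z u) (dz u)) +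
              dot (z u) (z u) * (c * expR (c * u))) _ _ t0).
  - have zc : {within `[0, t], continuous z}.
      apply: within_continuousB; first exact: (forward_within _ _ _ _ _ _ sol1).
      exact: (forward_within _ _ _ _ _ _ sol2).
    move=> x; apply: cvgM.
      by move: x; apply: continuous_subspaceT; exact: expR_scale_continuous.
    apply: (within_continuous_comp _ z (fun x => dot x x)) => //.
    by move=> y _; exact: dot_self_continuous.
  - move=> u ut.
    have dzu : is_derive u 1 z (dz u).
      exact: (is_deriveB (forward_is_derive _ _ _ _ _ _ _ sol1 (lexx 0) tT1 ut)
        (forward_is_derive _ _ _ _ _ _ _ sol2 (lexx 0) tT2 ut)).
    exact: (is_deriveM (is_derive_expR_scale c u)
      (is_derive_dot _ _ _ _ _ dzu dzu)).
  - move=> u ut; rewrite (dotC (dz u)).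
    have -> : forall e a b : R, e * (a + a) + b * (c * e) = e * (2 * a + c * b).
      by move=> *; ring.
    rewrite pmulr_rle0 ?expR_gt0//.
    have h := dot_twice_le (z u) (dz u).
    have : enorm (dz u) ^+ 2 <= (L * enorm (z u)) ^+ 2.
      have hL : enorm (dz u) <= L * enorm (z u).
        by rewrite enorm_distC opprK addrC; exact: lip.
      by rewrite lerXn2r ?nnegrE ?enorm_ge0// (le_trans (enorm_ge0 _) hL).
    rewrite exprMn !sqr_enorm /c; lra.
rewrite z0; have -> : dot (0 : 'rV[R]_n) 0 = 0.
  by apply: big1 => i _; rewrite mxE mulr0.
rewrite mulr0 pmulr_rle0 ?expR_gt0// => zz.
have z2 : enorm (z t) ^+ 2 = 0.
  by apply/eqP; rewrite eq_le sqr_ge0 sqr_enorm zz.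
apply/eqP; rewrite -subr_eq0 -normr_le0; apply: le_trans (norm_le_enorm _) _.
by move/eqP : z2; rewrite sqrf_eq0 => /eqP ->.
Qed.

(** * Global existence of solutions *)

(** This plays the role of the bound of a vector integral by the integral of the
    norm, for the exponential majorants of Picard iteration. *)
Lemma le_expR_of_derive_le {R : realType} {n : nat} (y dy : R -> 'rV[R]_n)
    (C c : R) :
  0 <= C -> continuous y -> y 0 = 0 ->
  (forall t : R, 0 < t -> is_derive t 1 y (dy t)) ->
  (forall t : R, 0 < t -> `|dy t| <= C * (c * expR (c * t))) ->
  forall t : R, 0 <= t -> `|y t| <= C * expR (c * t).
Proof.
move=> C0 cy y0 ydy bdy t t0.
have half (x dx : R -> R) : continuous x -> x 0 = 0 ->
    (forall t : R, 0 < t -> is_derive t 1 x (dx t)) ->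
    (forall t : R, 0 < t -> dx t <= C * (c * expR (c * t))) ->
    x t <= C * expR (c * t).
  move=> cx x0 xdx bdx.
  have : x t - C * expR (c * t) <= x 0 - C * expR (c * 0).
    apply: (derive_le0_nonincreasing (fun u => x u - C * expR (c * u))
      (fun u => dx u - C * (c * expR (c * u))) _ _ t0).
    - apply: continuous_subspaceT => u; apply: cvgB; first exact: cx.
      by apply: cvgM; [exact: cvg_cst|exact: expR_scale_continuous].
    - move=> u /andP[u0 _].
      exact: (is_deriveB (xdx _ u0) (is_deriveZ C (is_derive_expR_scale c u))).
    - by move=> u /andP[u0 _]; rewrite subr_le0 bdx.
  by rewrite x0 mulr0 expR0; lra.
apply: norm_le_coord => [|i]; first by rewrite mulr_ge0 ?expR_ge0.
have cyi : continuous (fun u => y u 0 i).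
  move=> u; exact: (@continuous_comp _ _ _ y (fun v : 'rV[R]_n => v 0 i) u (cy u)
    (@coord_continuous _ _ _ _ _ _)).
rewrite ler_norml lerNl; apply/andP; split.
  apply: (half (fun u => - y u 0 i) (fun u => - dy u 0 i)).
  - by move=> u; apply: cvgN; exact: cyi.
  - by rewrite y0 mxE oppr0.
  - move=> u u0; exact: (is_deriveN (is_derive_coord _ _ _ i (ydy _ u0))).
  - move=> u u0; apply: le_trans (bdy _ u0); apply: le_trans (coord_le_norm _ i).
    by rewrite -normrN ler_norm.
apply: (half (fun u => y u 0 i) (fun u => dy u 0 i)) => //.
- by rewrite y0 mxE.
- move=> u u0; exact: (is_derive_coord _ _ _ i (ydy _ u0)).
- move=> u u0; apply: le_trans (bdy _ u0); apply: le_trans (coord_le_norm _ i).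
  exact: ler_norm.
Qed.

Lemma primitive_R {R : realType} (h : R -> R) : continuous h ->
  exists H : R -> R, [/\ continuous H, H 0 = 0 &
    forall t : R, 0 < t -> is_derive t 1 H (h t)].
Proof.
move=> ch.
(* Integrating from [-1] makes [0] an interior point, where the primitive is
   continuous; it is then frozen at negative times. *)
pose G (x : R) := (\int[lebesgue_measure]_(t in `[-1, x]) h t)%R.
have dG (x : R) : -1 < x -> is_derive x 1 G (h x).
  move=> x1; have xx : x < x + 1 by lra.
  have [] := continuous_FTC1_closed xx _ x1 (ch x).
    apply: continuous_compact_integrable; first exact: segment_compact.
    exact: continuous_subspaceT.
  by move=> dG eG; apply: (DeriveDef dG); rewrite -derive1E; exact: eG.
have cG (x : R) : -1 < x -> {for x, continuous G}.
  by move=> /dG[dx _]; apply/differentiable_continuous/derivable1_diffP.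
exists (fun t => G (Num.max t 0) - G 0); split.
- move=> t; apply: cvgB; last exact: cvg_cst.
  have cmax : {for t, continuous (fun s : R => Num.max s 0)}.
    apply: (@continuous_max _ _ id (cst 0) t); first exact: cvg_id.
    exact: cst_continuous.
  have t1 : -1 < Num.max t 0.
    have : 0 <= Num.max t 0 by rewrite le_max lexx orbT.
    lra.
  exact: (@continuous_comp _ _ _ (fun s : R => Num.max s 0) G t cmax
    (cG _ t1)).
- by rewrite maxxx subrr.
- move=> t t0.
  have dt : is_derive t 1 (fun s => G s - G 0) (h t).
    have tm : -1 < t by lra.
    have := is_deriveB (dG t tm) (is_derive_cst (G 0) t (1 : R)).
    by rewrite subr0.
  apply: near_eq_is_derive dt.
  near=> s; congr (G _ - _); apply/esym/max_idPl; apply: ltW.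
  by near: s; exact: lt_nbhsr.
Unshelve. all: by end_near. Qed.

Lemma primitive_rV {R : realType} {n : nat} (h : R -> 'rV[R]_n) : continuous h ->
  exists H : R -> 'rV[R]_n, [/\ continuous H, H 0 = 0 &
    forall t : R, 0 < t -> is_derive t 1 H (h t)].
Proof.
move=> ch.
have chi i : continuous (fun t => h t 0 i).
  move=> t; exact: (@continuous_comp _ _ _ h (fun v : 'rV[R]_n => v 0 i) t (ch t)
    (@coord_continuous _ _ _ _ _ _)).
have [H HP] := choice (fun i => primitive_R _ (chi i)).
exists (fun t => \row_i H i t); split.
- move=> t; apply/cvgrPdist_le => e e0.
  near=> s; apply: norm_le_coord (ltW e0) _ => i; rewrite !mxE.
  move: i; near: s; apply: filter_forall => i.
  have [cH _ _] := HP i.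
  by have /cvgrPdist_le := cH t; exact.
- by apply/rowP => i; rewrite !mxE; case: (HP i).
- move=> t t0; apply: is_derive_rV => i; case: (HP i) => _ _ /(_ t t0).
  by congr is_derive; apply/funext => s; rewrite mxE.
Unshelve. all: by end_near. Qed.

Lemma div_expr2_small {R : realType} (a e : R) : 0 < e ->
  exists k : nat, a / 2 ^+ k <= e.
Proof.
move=> e0; exists (Num.bound (a / e)).
have := upper_nthrootP (leqnn (Num.bound (a / e))).
rewrite ltr_pdivrMr// => h; rewrite ler_pdivrMr ?exprn_gt0//.
by rewrite mulrC in h; exact: ltW.
Qed.

Lemma le0_of_le_div_expr2 {R : realType} (a x : R) :
  (forall k : nat, x <= a / 2 ^+ k) -> x <= 0.
Proof.
move=> xa; rewrite leNgt; apply/negP => x0.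
have [k ak] := div_expr2_small a (x / 2) ltac:(lra).
have := xa k; lra.
Qed.

Lemma geometric_steps_cvg {R : realType} {n : nat} (u : nat -> 'rV[R]_n)
    (D : R) :
  0 <= D -> (forall k, `|u k.+1 - u k| <= D / 2 ^+ k) ->
  exists l, forall k, `|l - u k| <= 2 * D / 2 ^+ k.
Proof.
move=> D0 ud.
have tail k j : `|u (k + j)%N - u k| <= 2 * D / 2 ^+ k.
  suff : `|u (k + j)%N - u k| <= 2 * D / 2 ^+ k - 2 * D / 2 ^+ (k + j).
    move=> h; apply: le_trans h _.
    by rewrite gerDl oppr_le0 divr_ge0 ?exprn_ge0//; lra.
  elim: j => [|j IH]; first by rewrite addn0 !subrr normr0.
  rewrite addnS -(subrKA (u (k + j)%N)).
  apply: le_trans (ler_normD _ _) _; apply: le_trans (lerD (ud _) IH) _.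
  rewrite exprS invfM.
  set p := (2 ^+ (k + j))^-1; set q := (2 ^+ k)^-1.
  by rewrite le_eqVlt; apply/orP; left; apply/eqP; field.
have : cvg (u k @[k --> \oo]).
  apply/cauchy_cvgP/cauchy_exP => e e0.
  have [k hk] := div_expr2_small (2 * D) (e / 2) ltac:(lra).
  exists (u k); exists k => //= m km; rewrite -ball_normE/= distrC.
  by have := tail k (m - k)%N; rewrite subnKC//; lra.
move=> /cvg_ex[l ul]; exists l => k.
have c : `|u m - u k| @[m --> \oo] --> `|l - u k|.
  by apply: cvg_norm; apply: cvgB => //; exact: cvg_cst.
apply: (cvgr_to_le c); exists k => //= m km.
by have := tail k (m - k)%N; rewrite subnKC.
Qed.

Lemma lipschitz_norm_continuous {R : realType} {n : nat}
    (F : 'rV[R]_n -> 'rV[R]_n) (K : R) :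
  0 < K -> (forall x y, `|F x - F y| <= K * `|x - y|) -> continuous F.
Proof.
move=> K0 lip x; apply/(@cvgrPdist_le _ _ _ _ (nbhs_filter x)) => e e0.
near=> y; apply: le_trans (lip _ _) _; rewrite mulrC -ler_pdivlMr//.
have : ball x (e / K) y by near: y; apply: nbhsx_ballx; exact: divr_gt0.
by rewrite -ball_normE/= => /ltW.
Unshelve. all: by end_near. Qed.

Lemma picard_lindelof {R : realType} {n : nat} (F : 'rV[R]_n -> 'rV[R]_n)
    (K : R) x0 :
  0 < K -> (forall x y, `|F x - F y| <= K * `|x - y|) ->
  exists gamma : R -> 'rV[R]_n, [/\ continuous gamma, gamma 0 = x0 &
    forall t : R, 0 < t -> is_derive t 1 gamma (F (gamma t))].
Proof.
move=> K0 lip.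
have cF := lipschitz_norm_continuous F K K0 lip.
have /choice[I IP] : forall h : R -> 'rV[R]_n, exists H : R -> 'rV[R]_n,
    continuous h -> [/\ continuous H, H 0 = 0 &
      forall t : R, 0 < t -> is_derive t 1 H (h t)].
  move=> h; have [ch|nch] := pselect (continuous h); last by exists h.
  by have [H HP] := primitive_rV _ ch; exists H.
pose step (g : R -> 'rV[R]_n) : R -> 'rV[R]_n := fun t => x0 + I (F \o g) t.
have cFg (g : R -> 'rV[R]_n) : continuous g -> continuous (F \o g).
  by move=> cg t; exact: (@continuous_comp _ _ _ g F t (cg t) (cF _)).
have step_cont (g : R -> 'rV[R]_n) : continuous g -> continuous (step g).
  move=> /cFg /IP[cI _ _] t; apply: cvgD; [exact: cvg_cst|exact: cI].
have step0 (g : R -> 'rV[R]_n) : continuous g -> step g 0 = x0.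
  by move=> /cFg /IP[_ I0 _]; rewrite /step I0 addr0.
have step_derive (g : R -> 'rV[R]_n) (t : R) : continuous g -> 0 < t ->
    is_derive t 1 (step g) (F (g t)).
  move=> /cFg /IP[_ _ dI] t0.
  have := is_deriveD (is_derive_cst x0 t (1 : R)) (dI t t0).
  by rewrite add0r.
(* The exponent [2 * K] is what halves the bound: the Lipschitz constant costs
   a factor [K], and integrating the weight [expR (2 * K * t)] divides by
   [2 * K]. *)
have step_contract (g h : R -> 'rV[R]_n) (C : R) :
    0 <= C -> continuous g -> continuous h ->
    (forall t : R, 0 < t -> `|g t - h t| <= C * expR (2 * K * t)) ->
    forall t : R, 0 <= t -> `|step g t - step h t| <= C / 2 * expR (2 * K * t).
  move=> C0 cg ch gh t t0.
  apply: (le_expR_of_derive_le (fun t => step g t - step h t)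
    (fun t => F (g t) - F (h t))) => //.
  - by lra.
  - by move=> s; apply: cvgB; exact: step_cont.
  - by rewrite !step0// subrr.
  - move=> s s0.
    exact: (is_deriveB (step_derive g s cg s0) (step_derive h s ch s0)).
  - move=> s s0; apply: le_trans (lip _ _) _.
    apply: le_trans (ler_wpM2l (ltW K0) (gh s s0)) _.
    by rewrite le_eqVlt; apply/orP; left; apply/eqP; field.
pose g_ k := iter k step (cst x0).
have cg_ k : continuous (g_ k).
  by elim: k => [|k IH]; [exact: cst_continuous|exact: step_cont].
pose C := `|F x0| / (2 * K).
have C0 : 0 <= C by rewrite divr_ge0//; lra.
have g_step k (t : R) : 0 <= t ->
    `|g_ k.+1 t - g_ k t| <= C * expR (2 * K * t) / 2 ^+ k.
  move=> t0; rewrite mulrAC; elim: k t t0 => [|k IH] t t0.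
    rewrite expr0 divr1.
    apply: (le_expR_of_derive_le (fun t => step (cst x0) t - x0)
      (fun=> F x0)) => //.
    - move=> s; apply: cvgB; last exact: cvg_cst.
      exact: (step_cont _ (cg_ 0%N)).
    - by rewrite (step0 _ (cg_ 0%N)) subrr.
    - move=> s s0.
      have := is_deriveB (step_derive _ s (cg_ 0%N) s0)
        (is_derive_cst x0 s (1 : R)).
      by rewrite subr0.
    - move=> s s0.
      have -> : C * (2 * K * expR (2 * K * s)) = `|F x0| * expR (2 * K * s).
        by rewrite /C; field; lra.
      by rewrite ler_peMr// -expR0 ler_expR !mulr_ge0// ltW.
  have -> : C / 2 ^+ k.+1 = C / 2 ^+ k / 2 by rewrite exprS invfM; ring.
  have Ck : 0 <= C / 2 ^+ k by rewrite divr_ge0// exprn_ge0.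
  apply: (step_contract (g_ k.+1) (g_ k) _ Ck (cg_ k.+1) (cg_ k) _ t t0).
  by move=> s /ltW; exact: IH.
(* The estimates hold for [t >= 0] only; freezing negative times at [0] makes
   the limit continuous on the whole line. *)
pose tau (t : R) := Num.max t 0.
have tau0 t : 0 <= tau t by rewrite le_max lexx orbT.
have ctau : continuous tau.
  move=> t; apply: (@continuous_max _ _ id (cst 0) t); first exact: cvg_id.
  exact: cst_continuous.
have limit : forall t : R, exists l : 'rV[R]_n, forall k,
    `|l - g_ k (tau t)| <= 2 * (C * expR (2 * K * tau t)) / 2 ^+ k.
  move=> t; apply: (geometric_steps_cvg (fun k => g_ k (tau t))).
    by rewrite mulr_ge0 ?expR_ge0.
  by move=> k; exact: g_step.
have [g gP] := choice limit.
have cg : continuous g.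
  move=> t; apply/cvgrPdist_le => e e0.
  have [k hk] := div_expr2_small (2 * (C * expR (2 * K * (tau t + 1)))) (e / 3)
    ltac:(lra).
  have err s : tau s <= tau t + 1 -> `|g s - g_ k (tau s)| <= e / 3.
    move=> st; apply: le_trans (gP s k) _; apply: le_trans hk.
    rewrite ler_pM2r ?invr_gt0 ?exprn_gt0// ler_pM2l// ler_wpM2l// ler_expR.
    by rewrite ler_pM2l//; lra.
  near=> s.
  have -> : g t - g s = (g t - g_ k (tau t)) + (g_ k (tau t) - g_ k (tau s))
      + (g_ k (tau s) - g s) by rewrite !addrA !subrK.
  have e1 : `|g t - g_ k (tau t)| <= e / 3 by apply: err; lra.
  have e2 : `|g_ k (tau s) - g s| <= e / 3.
    rewrite distrC; apply: err; near: s.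
    by apply: (cvgr_le (tau t) (ctau t)); lra.
  have e3 : `|g_ k (tau t) - g_ k (tau s)| <= e / 3.
    near: s; apply: cvgr_dist_le; last by lra.
    exact: (@continuous_comp _ _ _ tau (g_ k) t (ctau t) (cg_ k _)).
  apply: le_trans (ler_normD _ _) _.
  have := ler_normD (g t - g_ k (tau t)) (g_ k (tau t) - g_ k (tau s)); lra.
(* [step g] is differentiable by construction, and equals [g] for [t >= 0]
   because both are limits of the iterates. *)
exists (step g); split; [exact: step_cont|exact: step0|].
move=> t t0; have -> : F (step g t) = F (g t); last exact: step_derive.
have gerr k (s : R) : 0 <= s ->
    `|g s - g_ k s| <= 2 * C / 2 ^+ k * expR (2 * K * s).
  move=> s0; have := gP s k.
  by rewrite /tau (max_idPl s0); congr (is_true (_ <= _)); ring.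
congr F; apply/eqP; rewrite -subr_eq0 -normr_le0.
apply: (le0_of_le_div_expr2 (2 * C * expR (2 * K * t))) => k.
rewrite -(subrKA (g_ k.+1 t)); apply: le_trans (ler_normD _ _) _.
have h1 : `|step g t - g_ k.+1 t| <= 2 * C / 2 ^+ k / 2 * expR (2 * K * t).
  apply: step_contract => //; last exact: ltW.
    by rewrite divr_ge0 ?exprn_ge0//; lra.
  by move=> s /ltW; exact: gerr.
have h2 := gerr k.+1 t (ltW t0); rewrite distrC in h2.
apply: le_trans (lerD h1 h2) _; rewrite exprS invfM.
by rewrite le_eqVlt; apply/orP; left; apply/eqP; field.
Unshelve. all: by end_near. Qed.

Lemma C11_global_solution {R : realType} {n : nat} (f : 'rV[R]_n -> R) x0 :
  C11 f -> exists gamma, forward_solution f x0 +oo%E gamma.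
Proof.
move=> [_ [L lip]].
pose K := `|L| * Num.sqrt n%:R + 1.
have K0 : 0 < K by rewrite ltr_wpDl// mulr_ge0// sqrtr_ge0.
have lipF x y : `|- gradient f x - - gradient f y| <= K * `|x - y|.
  rewrite -opprD normrN; apply: le_trans (norm_le_enorm _) _.
  apply: le_trans (lip _ _) _.
  apply: (@le_trans _ _ (`|L| * (Num.sqrt n%:R * `|x - y|))).
    apply: (@le_trans _ _ (`|L| * enorm (x - y))).
      by rewrite ler_wpM2r ?enorm_ge0// ler_norm.
    by rewrite ler_wpM2l// enorm_le_norm.
  by rewrite mulrA ler_wpM2r// /K lerDl.
have [g [cg g0 dg]] := picard_lindelof (fun x => - gradient f x) K x0 K0 lipF.
exists g; split=> //.
  exact: continuous_subspaceT.
by move=> t t0 _; exact: dg.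
Qed.

(** A maximal solution coincides with the global one as long as it exists, so the
    latter would extend it if it stopped. *)
Lemma orbit_global {R : realType} {n : nat} (f : 'rV[R]_n -> R) x0 T gamma :
  C11 f -> is_orbit f x0 T gamma -> T = +oo%E.
Proof.
move=> c11 [sol maxT]; have [g solg] := C11_global_solution f x0 c11.
have [_ [L lip]] := c11.
apply/eqP; rewrite -leye_eq; apply: (maxT _ _ solg) => t.
rewrite inE => -[t0 tT].
by apply: (forward_solution_unique _ _ _ _ _ _ _ lip solg sol) => //; exact: ltry.
Qed.

(** * Convergence and finite length of orbits *)

Theorem corollary6p3 (R : realType) (f : 'rV[R]_2 -> R)
    (f_coercive : coercive f) (f_C11 : C11 f) (f_qconvex : quasiconvex f)
    (x0 : 'rV[R]_2) :
  (exists (T : \bar R) (gamma : R -> 'rV[R]_2), is_orbit f x0 T gamma) /\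
  (forall (T : \bar R) (gamma : R -> 'rV[R]_2), is_orbit f x0 T gamma ->
    [/\ T = +oo%E,
        cvg (gamma t @[t --> +oo])
      & (curve_length (forward_itv T) gamma < +oo)%E]).
Proof.
split.
  have [gamma sol] := C11_global_solution f x0 f_C11.
  by exists +oo%E, gamma; split=> // T' g _ _; exact: leey.
move=> T gamma orb; have [[df _] _] := f_C11.
have TE := orbit_global _ _ _ _ f_C11 orb.
case: orb => sol _; rewrite TE in sol *.
have sc := orbit_self_contracted _ _ _ _ df f_qconvex sol.
have [B B0 gB] := coercive_orbit_bounded _ _ _ _ df f_coercive sol.
split=> //; first exact: self_contracted_cvg sc gB.
apply: le_lt_trans (ltry (192 * B)).
exact: self_contracted_length_bounded sc B0 gB.
Qed.
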